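(* Consider FedAvg with full device participation as described in the context, and let Assumptions (A1)–(A4) hold. Set $\gamma = \max\{8L/\mu,\, E\}$ and learning rates $\eta_t = \frac{2}{\mu(\gamma+t)}$, and let $$B = \sum_{k=1}^N p_k^2\sigma_k^2 + 6L\Gamma + 8(E-1)^2 G^2 .$$ Let $\mathcal{R}$ be a data reconstruction function that is $L_{\mathcal{R}}$-Lipschitz, and let $\mathbf{x}$ be the private data. Then for every round $t \ge 1$, $$\mathbb{E}\,\|\mathbf{x} - \mathcal{R}(\mathbf{w}_t)\|^2 \;\le\; 2\,\mathbb{E}\,\|\mathbf{x} - \mathcal{R}(\mathbf{w}^\star)\|^2 + \frac{2L_{\mathcal{R}}^2}{\gamma + t}\left( \frac{4B}{\mu^2} + (\gamma+1)\,\mathbb{E}\,\|\mathbf{w}_1 - \mathbf{w}^\star\|^2 \right).$$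
   Context: Federated setting: there are $N$ devices with weights $p_k \ge 0$, $\sum_{k=1}^N p_k = 1$. Device $k$ holds a finite dataset $D^k$ and has local objective $\mathcal{L}_k(\mathbf{w}) = \frac{1}{n_k}\sum_{j=1}^{n_k} \ell(\mathbf{w}; (\mathbf{x}^k_j, y^k_j))$; for a sample $\xi$ of $D^k$, $\nabla\mathcal{L}_k(\mathbf{w},\xi)$ denotes the stochastic gradient of the loss at that sample. The global objective is $\mathcal{L}(\mathbf{w}) = \sum_{k=1}^N p_k \mathcal{L}_k(\mathbf{w})$, with minimizer $\mathbf{w}^\star$ and minimum value $\mathcal{L}^\ast$; $\mathcal{L}_k^\ast$ is the minimum value of $\mathcal{L}_k$, and $\Gamma = \mathcal{L}^\ast - \sum_{k=1}^N p_k \mathcal{L}_k^\ast \ (\ge 0)$. FedAvg with full participation: fix an integer $E \ge 1$ and let $\mathcal{I}_E = \{nE : n = 1,2,\dots\}$. All devices start at a common (possibly random) $\mathbf{w}_1^k = \mathbf{w}_1$. For $t = 1,2,\dots$, each device computes $\mathbf{v}^k_{t+1} = \mathbf{w}^k_t - \eta_t \nabla \mathcal{L}_k(\mathbf{w}^k_t, \xi^k_t)$, where $\xi^k_t$ is drawn uniformly at random from $D^k$ (independently). If $t+1 \notin \mathcal{I}_E$ then $\mathbf{w}^k_{t+1} = \mathbf{v}^k_{t+1}$; if $t+1 \in \mathcal{I}_E$ then $\mathbf{w}^k_{t+1} = \sum_{j=1}^N p_j \mathbf{v}^j_{t+1}$ for all $k$. The global model at step $t$ is $\mathbf{w}_t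 = \sum_{k=1}^N p_k \mathbf{w}^k_t$. Assumptions: (A1) each $\mathcal{L}_k$ is $L$-smooth: $\mathcal{L}_k(\mathbf{v}) \le \mathcal{L}_k(\mathbf{w}) + (\mathbf{v}-\mathbf{w})^\top\nabla\mathcal{L}_k(\mathbf{w}) + \frac{L}{2}\|\mathbf{v}-\mathbf{w}\|_2^2$ for all $\mathbf{v},\mathbf{w}$. (A2) each $\mathcal{L}_k$ is $\mu$-strongly convex ($\mu>0$): $\mathcal{L}_k(\mathbf{v}) \ge \mathcal{L}_k(\mathbf{w}) + (\mathbf{v}-\mathbf{w})^\top\nabla\mathcal{L}_k(\mathbf{w}) + \frac{\mu}{2}\|\mathbf{v}-\mathbf{w}\|_2^2$. (A3) $\mathbb{E}\|\nabla\mathcal{L}_k(\mathbf{w}^k_t,\xi^k_t) - \nabla\mathcal{L}_k(\mathbf{w}^k_t)\|^2 \le \sigma_k^2$ for all $k,t$. (A4) $\mathbb{E}\|\nabla\mathcal{L}_k(\mathbf{w}^k_t,\xi^k_t)\|^2 \le G^2$ for all $k,t$. Reconstruction: the private data is $\mathbf{x}\in[0,1]^d$. A data reconstruction function $\mathcal{R}$ maps model parameters to a reconstruction in $\mathbb{R}^d$; it may be randomized (e.g. random initialization), with randomness independent of the FL training, and for every realization of its randomness it satisfies $\|\mathcal{R}(\mathbf{v}) - \mathcal{R}(\mathbf{w})\| \le L_{\mathcal{R}}\|\mathbf{v}-\mathbf{w}\|$ for all $\mathbf{v},\mathbf{w}$. All expectations are over all randomness (stochastic gradients and the randomness of $\mathcal{R}$).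 *)

(* Defs.v *)
From HB Require Import structures.
From mathcomp Require Import all_boot all_order all_algebra.
From mathcomp Require Import all_classical all_reals all_analysis.
Set Implicit Arguments. Unset Strict Implicit. Unset Printing Implicit Defensive.
Import Order.TTheory GRing.Theory Num.Theory.
Import numFieldNormedType.Exports.
Local Open Scope ring_scope.

Section Defs.
Variable R : realType.

Definition dotv (m : nat) (u v : 'rV[R]_m) : R := \sum_(i < m) u 0 i * v 0 i.
Definition sqnorm (m : nat) (u : 'rV[R]_m) : R := dotv u u.
Definition enorm (m : nat) (u : 'rV[R]_m) : R := Num.sqrt (sqnorm u).

Definition avg (S : finType) (F : S -> R) : R := (#|S|%:R)^-1 * \sum_(s : S) F s.

(** A simultaneous draw of one sample index per device. *)
Definition Draw (N : nat) (n : 'I_N -> nat) := {dffun forall k : 'I_N, 'I_(n k)}.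

Definition Lloc (m N : nat) (n : 'I_N -> nat)
  (loss : forall k : 'I_N, 'I_(n k) -> 'rV[R]_m -> R) (k : 'I_N) (w : 'rV[R]_m) : R :=
  (n k)%:R^-1 * \sum_(j < n k) loss k j w.
Definition gradLloc (m N : nat) (n : 'I_N -> nat)
  (g : forall k : 'I_N, 'I_(n k) -> 'rV[R]_m -> 'rV[R]_m) (k : 'I_N) (w : 'rV[R]_m)
  : 'rV[R]_m := (n k)%:R^-1 *: \sum_(j < n k) g k j w.
Definition Lglob (m N : nat) (n : 'I_N -> nat) (p : 'I_N -> R)
  (loss : forall k : 'I_N, 'I_(n k) -> 'rV[R]_m -> R) (w : 'rV[R]_m) : R :=
  \sum_(k < N) p k * Lloc loss k w.

(** FedAvg local iterates with full participation.
    [xi : {ffun 'I_T -> Draw n}] lists the sample draws xi_1, ..., xi_T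
    (xi_t is stored at index t-1).  [fedavg_loc ... s k] is w^k_{s+1}
    (time t = s+1); w^k_1 = w1.  Beyond the horizon T the iterates are frozen
    (never used).  [eta t] is the step size eta_t. *)
Fixpoint fedavg_loc (m N : nat) (n : 'I_N -> nat) (p : 'I_N -> R)
  (g : forall k : 'I_N, 'I_(n k) -> 'rV[R]_m -> 'rV[R]_m)
  (eta : nat -> R) (E : nat) (w1 : 'rV[R]_m) (T : nat) (xi : {ffun 'I_T -> Draw n})
  (s : nat) : 'I_N -> 'rV[R]_m :=
  match s with
  | 0 => fun _ => w1
  | s'.+1 =>
    let prev := fedavg_loc p g eta E w1 xi s' in
    match (insub s' : option 'I_T) with
    | None => prev
    | Some i =>
      (* time t = s'+1 ; v^k_{t+1} = w^k_t - eta_t grad L_k(w^k_t, xi^k_t) *)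
      let v := fun k => prev k - eta s'.+1 *: g k (xi i k) (prev k) in
      if (E %| s'.+2)%N (* t+1 in I_E *) then (fun _ => \sum_(j < N) p j *: v j)
      else v
    end
  end.

Definition fedavg_glob (m N : nat) (n : 'I_N -> nat) (p : 'I_N -> R)
  (g : forall k : 'I_N, 'I_(n k) -> 'rV[R]_m -> 'rV[R]_m)
  (eta : nat -> R) (E : nat) (w1 : 'rV[R]_m) (T : nat) (xi : {ffun 'I_T -> Draw n})
  (t : nat) : 'rV[R]_m :=
  \sum_(k < N) p k *: fedavg_loc p g eta E w1 xi t.-1 k.

(** Expectation over all randomness: the external randomness omega (random
    initialisation, randomness of the reconstruction function) lives on a
    probability space; the sample draws xi_1..xi_T are independent and uniform,
    independent of omega, so the expectation over them is the uniform average. *)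
Definition Exp (d : measure_display) (Omega : measurableType d)
  (P : probability Omega R) (S : finType) (F : Omega -> S -> R) : \bar R :=
  (\int[P]_(om in setT) (avg (F om))%:E)%E.

End Defs.

(* Main.v *)
(** Lipschitz continuity of the reconstruction reduces the claim to the rate
    E |w_t - w*|^2 <= v / (gamma + t).  Conditionally on the past, the stochastic
    gradients are unbiased and independent across devices, so one step costs a
    variance sum_k p_k^2 sigma_k^2; smoothness and strong convexity contract the
    distance of the averaged iterate to w* by 1 - eta_t mu, up to 6 L eta_t^2 Gamma
    and twice the spread of the local models; that spread is at most
    4 eta_t^2 (E-1)^2 G^2 because the last synchronisation is fewer than E steps
    old.  The resulting recursion D' <= (1 - eta_t mu) D + eta_t^2 B has the
    supersolution v / (gamma + t). *)
Require Import Defs.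
From HB Require Import structures.
From mathcomp Require Import all_boot all_order all_algebra.
From mathcomp Require Import all_classical all_reals all_analysis.
From mathcomp Require Import measurable_realfun ring lra.
Import Order.TTheory GRing.Theory Num.Theory.
Import numFieldNormedType.Exports.
Set Implicit Arguments. Unset Strict Implicit. Unset Printing Implicit Defensive.
Local Open Scope ring_scope.

(** * Bilinearity of the inner product and Young's inequality *)

Section Dot.
Variables (R : realType) (m : nat).
Implicit Types (u v w : 'rV[R]_m).

Lemma dotvC u v : dotv u v = dotv v u.
Proof. by apply: eq_bigr => i _; rewrite mulrC. Qed.

Lemma dotvDl u v w : dotv (u + v) w = dotv u w + dotv v w.
Proof. by rewrite -big_split; apply: eq_bigr => i _; rewrite mxE mulrDl. Qed.

Lemma dotvZl a u v : dotv (a *: u) v = a * dotv u v.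
Proof. by rewrite mulr_sumr; apply: eq_bigr => i _; rewrite mxE mulrA. Qed.

Lemma dotvDr u v w : dotv w (u + v) = dotv w u + dotv w v.
Proof. by rewrite !(dotvC w) dotvDl. Qed.

Lemma dotvZr a u v : dotv v (a *: u) = a * dotv v u.
Proof. by rewrite !(dotvC v) dotvZl. Qed.

Lemma dotvNl u v : dotv (- u) v = - dotv u v.
Proof. by rewrite -scaleN1r dotvZl mulN1r. Qed.

Lemma dotvNr u v : dotv u (- v) = - dotv u v.
Proof. by rewrite dotvC dotvNl dotvC. Qed.

Lemma dotv0r u : dotv u 0 = 0.
Proof. by rewrite -(scale0r 0) dotvZr mul0r. Qed.

Lemma dotv_sumr (I : Type) (r : seq I) (f : I -> 'rV[R]_m) u :
  dotv u (\sum_(i <- r) f i) = \sum_(i <- r) dotv u (f i).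
Proof.
elim: r => [|i r IH]; first by rewrite !big_nil dotv0r.
by rewrite !big_cons dotvDr IH.
Qed.

Lemma dotv_suml (I : Type) (r : seq I) (f : I -> 'rV[R]_m) u :
  dotv (\sum_(i <- r) f i) u = \sum_(i <- r) dotv (f i) u.
Proof. by rewrite dotvC dotv_sumr; apply: eq_bigr => i _; rewrite dotvC. Qed.

Definition dotvE := (dotvDl, dotvDr, dotvZl, dotvZr, dotvNl, dotvNr).

Lemma sqnorm_ge0 u : 0 <= sqnorm u.
Proof. by apply: sumr_ge0 => i _; rewrite -expr2 sqr_ge0. Qed.

Lemma sqnormZ a u : sqnorm (a *: u) = a ^+ 2 * sqnorm u.
Proof. by rewrite /sqnorm !dotvE mulrA. Qed.

Lemma sqnormN u : sqnorm (- u) = sqnorm u.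
Proof. by rewrite /sqnorm !dotvE opprK. Qed.

Lemma sqnorm_dist u v : sqnorm (u - v) = sqnorm (v - u).
Proof. by rewrite /sqnorm !dotvE; ring. Qed.

Lemma sqnorm_eq0 u : sqnorm u = 0 -> u = 0.
Proof.
move/eqP; rewrite psumr_eq0 => [/allP u0|i _]; last by rewrite -expr2 sqr_ge0.
apply/rowP => i; rewrite mxE; have := u0 i (mem_index_enum i).
by rewrite /= -expr2 sqrf_eq0 => /eqP.
Qed.

(** The difference of the two sides is [c^-1 * sqnorm (u - c *: v)]. *)
Lemma young_dotv c u v : 0 < c ->
  2 * dotv u v <= c^-1 * sqnorm u + c * sqnorm v.
Proof.
move=> c0; have := sqnorm_ge0 (u - c *: v).
have -> : sqnorm (u - c *: v) = sqnorm u - 2 * c * dotv u v + c ^+ 2 * sqnorm v.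
  by rewrite /sqnorm !dotvE (dotvC v u); ring.
move=> h; have -> : c^-1 * sqnorm u + c * sqnorm v = 2 * dotv u v
    + c^-1 * (sqnorm u - 2 * c * dotv u v + c ^+ 2 * sqnorm v).
  by field; rewrite gt_eqF.
by rewrite lerDl mulr_ge0// invr_ge0 ltW.
Qed.

Lemma sqnormD_le (a : R) u v : 0 < a ->
  sqnorm (u + v) <= (1 + a^-1) * sqnorm u + (1 + a) * sqnorm v.
Proof.
move=> a0; have := young_dotv u v a0.
have -> : sqnorm (u + v) = sqnorm u + 2 * dotv u v + sqnorm v.
  by rewrite /sqnorm !dotvE (dotvC v u); ring.
lra.
Qed.

Lemma sqnorm_enorm u : enorm u ^+ 2 = sqnorm u.
Proof. by rewrite sqr_sqrtr ?sqnorm_ge0. Qed.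

Lemma enorm_ge0 u : 0 <= enorm u.
Proof. exact: sqrtr_ge0. Qed.

End Dot.

(** * Weighted means and the bias-variance decomposition *)

Section Weighted.
Variables (R : realType) (m N : nat) (p : 'I_N -> R).
Hypotheses (p0 : forall k, 0 <= p k) (p1 : \sum_(k < N) p k = 1).
Implicit Types (u : 'I_N -> 'rV[R]_m) (c : 'rV[R]_m).

Lemma sum_weighted_cst c : \sum_(k < N) p k *: c = c.
Proof. by rewrite -scaler_suml p1 scale1r. Qed.

(** Expanding around the weighted mean, the cross term vanishes because the weighted deviations from
    the mean sum to zero. Dropping either summand yields the two inequalities below. *)
Lemma weighted_bias_variance u c :
  \sum_(k < N) p k * sqnorm (u k - c) =
  \sum_(k < N) p k * sqnorm (u k - \sum_(j < N) p j *: u j)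
  + sqnorm (\sum_(j < N) p j *: u j - c).
Proof.
set b := \sum_(j < N) p j *: u j.
have e k : p k * sqnorm (u k - c) = p k * sqnorm (u k - b)
    + (p k * sqnorm (b - c) + 2 * dotv (p k *: u k - p k *: b) (b - c)).
  rewrite -{1}(subrK b (u k)) -addrA.
  move: (u k - b) (b - c) (scalerBr (p k) (u k) b) => y z <-.
  by rewrite /sqnorm !dotvE (dotvC z y); ring.
rewrite (eq_bigr _ (fun k _ => e k)) !big_split /= -mulr_suml p1 mul1r.
rewrite -[X in _ + (_ + X)]mulr_sumr -dotv_suml sumrB -/b sum_weighted_cst subrr.
by rewrite dotvC dotv0r mulr0 addr0.
Qed.

Lemma weighted_variance_le u c :
  \sum_(k < N) p k * sqnorm (u k - \sum_(j < N) p j *: u j) <=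
  \sum_(k < N) p k * sqnorm (u k - c).
Proof. by rewrite [leRHS]weighted_bias_variance lerDl sqnorm_ge0. Qed.

Lemma weighted_sqnorm_le u c :
  sqnorm (\sum_(j < N) p j *: u j - c) <= \sum_(k < N) p k * sqnorm (u k - c).
Proof.
rewrite [leRHS]weighted_bias_variance lerDr sumr_ge0// => k _.
by rewrite mulr_ge0 ?sqnorm_ge0.
Qed.

End Weighted.

(** * Uniform averages over finite sets and resampling *)

Section Averages.
Variable R : realType.

Lemma eq_avg (S : finType) (F H : S -> R) : F =1 H -> avg F = avg H.
Proof. by move=> e; rewrite /avg (eq_bigr _ (fun s _ => e s)). Qed.

Lemma avg_ge0 (S : finType) (F : S -> R) : (forall s, 0 <= F s) -> 0 <= avg F.
Proof. by move=> h; rewrite mulr_ge0 ?invr_ge0 ?sumr_ge0. Qed.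

Lemma le_avg (S : finType) (F H : S -> R) :
  (forall s, F s <= H s) -> avg F <= avg H.
Proof. by move=> h; rewrite ler_wpM2l ?invr_ge0// ler_sum. Qed.

Lemma avgD (S : finType) (F H : S -> R) :
  avg (fun s => F s + H s) = avg F + avg H.
Proof. by rewrite /avg big_split mulrDr. Qed.

Lemma avgZ (S : finType) a (F : S -> R) : avg (fun s => a * F s) = a * avg F.
Proof. by rewrite /avg -mulr_sumr mulrCA. Qed.

Lemma avg_sum (S I : finType) (F : I -> S -> R) :
  avg (fun s => \sum_i F i s) = \sum_i avg (F i).
Proof. by rewrite /avg exchange_big mulr_sumr. Qed.

Lemma avg_cst (S : finType) a : (0 < #|S|)%N -> avg (fun _ : S => a : R) = a.
Proof.
move=> S0; rewrite /avg sumr_const -(mulr_natl a) mulrA mulVf ?mul1r//.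
by rewrite pnatr_eq0 -lt0n.
Qed.

(* The map (x, a) |-> (upd x a, get x) is an involution of S * A, so resampling
   the component [get] leaves a uniform average unchanged. *)
Lemma avg_resample (S A : finType) (get : S -> A) (upd : S -> A -> S)
    (F : S -> R) :
  (forall x a, get (upd x a) = a) ->
  (forall x a, upd (upd x a) (get x) = x) ->
  (0 < #|A|)%N ->
  avg F = avg (fun x => avg (fun a => F (upd x a))).
Proof.
move=> gu uu A0; rewrite /avg; congr (_ * _).
rewrite -mulr_sumr pair_big /=.
pose sw (xa : S * A) := (upd xa.1 xa.2, get xa.1).
have swK : involutive sw by case=> x a; rewrite /sw /= gu uu.
rewrite (reindex_inj (inv_inj swK)) /sw /=.
under [in RHS]eq_bigr do rewrite uu.
rewrite -(pair_bigA _ (fun x _ => F x)) /=.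
under [in RHS]eq_bigr do rewrite sumr_const -(mulr_natl (F _)).
by rewrite -mulr_sumr mulrA mulVf ?mul1r// pnatr_eq0 -lt0n.
Qed.

Lemma avg_marginal (S A : finType) (get : S -> A) (upd : S -> A -> S)
    (F : A -> R) :
  (forall x a, get (upd x a) = a) ->
  (forall x a, upd (upd x a) (get x) = x) ->
  (0 < #|A|)%N -> (0 < #|S|)%N ->
  avg (fun x => F (get x)) = avg F.
Proof.
move=> gu uu A0 S0; rewrite (avg_resample _ gu uu)//.
by under eq_avg do under eq_avg do rewrite gu; rewrite avg_cst.
Qed.

End Averages.

(** * Deterministic contraction of one averaged gradient step *)

Section Descent.
Variables (R : realType) (m N : nat) (p : 'I_N -> R).
Hypotheses (p0 : forall k, 0 <= p k) (p1 : \sum_(k < N) p k = 1).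
Variables (F : 'I_N -> 'rV[R]_m -> R) (dF : 'I_N -> 'rV[R]_m -> 'rV[R]_m).
Variables (Fmin : 'I_N -> R) (L mu : R) (wstar : 'rV[R]_m).
Hypothesis L0 : 0 < L.
Hypothesis mu0 : 0 <= mu.
Hypothesis smoothF : forall k v w,
  F k v <= F k w + dotv (v - w) (dF k w) + L / 2 * sqnorm (v - w).
Hypothesis convexF : forall k v w,
  F k w + dotv (v - w) (dF k w) + mu / 2 * sqnorm (v - w) <= F k v.
Hypothesis FminP : forall k w, Fmin k <= F k w.
Hypothesis wstarP : forall w,
  \sum_(k < N) p k * F k wstar <= \sum_(k < N) p k * F k w.

(** A gradient step of length [L^-1] lowers [F k] by at least [sqnorm (dF k w) / (2 * L)], and it
    cannot go below [Fmin k]. *)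
Lemma sqnorm_grad_le k w : sqnorm (dF k w) <= 2 * L * (F k w - Fmin k).
Proof.
have := le_trans (FminP k _) (smoothF k (w - L^-1 *: dF k w) w).
have -> : w - L^-1 *: dF k w - w = - (L^-1 *: dF k w) by rewrite addrAC subrr sub0r.
rewrite dotvNl dotvZl -/(sqnorm (dF k w)) sqnormN sqnormZ.
have -> : F k w - L^-1 * sqnorm (dF k w) + L / 2 * (L^-1 ^+ 2 * sqnorm (dF k w))
  = F k w - sqnorm (dF k w) / (2 * L) by field; rewrite gt_eqF.
move=> h2; have : sqnorm (dF k w) / (2 * L) <= F k w - Fmin k by lra.
by rewrite ler_pdivrMr ?mulr_gt0// mulrC.
Qed.

Lemma descent_step eta (y : 'I_N -> 'rV[R]_m) (b := \sum_(k < N) p k *: y k) :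
  0 < eta -> 4 * L * eta <= 1 ->
  sqnorm (b - wstar - eta *: \sum_(k < N) p k *: dF k (y k)) <=
  (1 - eta * mu) * sqnorm (b - wstar)
  + 6 * L * eta ^+ 2 *
      (\sum_(k < N) p k * F k wstar - \sum_(k < N) p k * Fmin k)
  + 2 * \sum_(k < N) p k * sqnorm (y k - b).
Proof.
move=> e0 eL.
set D := \sum_(k < N) p k *: dF k (y k).
set Fw := \sum_(k < N) p k * F k wstar.
set Fm := \sum_(k < N) p k * Fmin k.
set V := \sum_(k < N) p k * sqnorm (y k - b).
pose Q := \sum_(k < N) p k * sqnorm (dF k (y k)).
pose Qb := \sum_(k < N) p k * sqnorm (dF k b).
pose Fy := \sum_(k < N) p k * F k (y k).
pose Fb := \sum_(k < N) p k * F k b.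
pose W := \sum_(k < N) p k * sqnorm (y k - wstar).
pose C1 := \sum_(k < N) p k * dotv (y k - b) (dF k (y k)).
pose C2 := \sum_(k < N) p k * dotv (y k - wstar) (dF k (y k)).
pose H := \sum_(k < N) p k * dotv (y k - b) (dF k b).
have V0 : 0 <= V by apply: sumr_ge0 => k _; rewrite mulr_ge0 ?sqnorm_ge0.
have hD : sqnorm D <= Q.
  have := weighted_sqnorm_le p0 p1 (fun k => dF k (y k)) 0.
  by rewrite subr0; under [in leRHS]eq_bigr do rewrite subr0.
(* Strong convexity at [y k] controls [C2]; the error [C1] of measuring from [y k] instead of [b] is
   charged to the spread [V]. *)
have hdot : dotv (b - wstar) D = C2 - C1.
  rewrite dotv_sumr -sumrB; apply: eq_bigr => k _.
  by rewrite dotvZr -mulrBr !dotvE; ring.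
have young (z : 'I_N -> 'rV[R]_m) : 2 * \sum_(k < N) p k * dotv (y k - b) (z k)
    <= eta^-1 * V + eta * \sum_(k < N) p k * sqnorm (z k).
  rewrite !mulr_sumr -big_split /=; apply: ler_sum => k _.
  rewrite (mulrCA 2) (mulrCA eta^-1) (mulrCA eta) -mulrDr.
  by rewrite ler_wpM2l// young_dotv.
have hC1 : 2 * C1 <= eta^-1 * V + eta * Q by exact: young.
have hH : - 2 * H <= eta^-1 * V + eta * Qb.
  have := young (fun k => - dF k b).
  under eq_bigr do rewrite dotvNr mulrN.
  under [in leRHS]eq_bigr do rewrite sqnormN.
  by rewrite sumrN -/Qb -/H; lra.
have hC2 : Fy - C2 + mu / 2 * W <= Fw.
  rewrite /Fy /C2 /W -sumrB mulr_sumr -big_split /=; apply: ler_sum => k _.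
  rewrite (mulrCA (mu / 2)) -mulrBr -mulrDr ler_wpM2l//.
  have := convexF k wstar (y k); rewrite (sqnorm_dist wstar).
  by rewrite -(opprB (y k)) dotvNl; lra.
have hQ : Q <= 2 * L * (Fy - Fm).
  rewrite /Q /Fy /Fm -sumrB mulr_sumr; apply: ler_sum => k _.
  by rewrite -mulrBr (mulrCA (2 * L)) ler_wpM2l// sqnorm_grad_le.
have hQb : Qb <= 2 * L * (Fb - Fm).
  rewrite /Qb /Fb /Fm -sumrB mulr_sumr; apply: ler_sum => k _.
  by rewrite -mulrBr (mulrCA (2 * L)) ler_wpM2l// sqnorm_grad_le.
have hW : sqnorm (b - wstar) <= W by exact: weighted_sqnorm_le.
have hFy : Fb + H <= Fy.
  rewrite /Fy /Fb /H -big_split /=; apply: ler_sum => k _.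
  rewrite -mulrDr ler_wpM2l//; have := convexF k (y k) b.
  have : 0 <= mu / 2 * sqnorm (y k - b).
    by rewrite mulr_ge0 ?sqnorm_ge0 ?divr_ge0.
  lra.
have hFb : Fw <= Fb by exact: wstarP.
have G0 : 0 <= Fw - Fm.
  by rewrite subr_ge0; apply: ler_sum => k _; rewrite ler_wpM2l.
have -> : sqnorm (b - wstar - eta *: D) =
    sqnorm (b - wstar) - 2 * eta * (C2 - C1) + eta ^+ 2 * sqnorm D.
  by rewrite -hdot; move: (b - wstar) => z; rewrite /sqnorm !dotvE (dotvC D z); ring.
move: (sqnorm _) (sqnorm _) hD hW => sD n.
clear -e0 eL L0 mu0 V0 hC1 hH hC2 hQ hQb hFy hFb G0 => hD hW.
have eV x : eta * (eta^-1 * V + eta * x) = V + eta ^+ 2 * x.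
  by field; rewrite gt_eqF.
have {}hC1 := ler_wpM2l (ltW e0) hC1.
have {}hH := ler_wpM2l (ltW e0) hH.
rewrite !eV in hC1 hH.
have {}hD := ler_wpM2l (sqr_ge0 eta) hD.
have {}hQ := ler_wpM2l (sqr_ge0 eta) hQ.
have {}hQb := ler_wpM2l (sqr_ge0 eta) hQb.
have {}hC2 := ler_wpM2l (ltW e0) hC2.
have {}hW := ler_wpM2l (mulr_ge0 (ltW e0) mu0) hW.
have {}hFy := ler_wpM2l (ltW e0) hFy.
have Le0 : 0 <= L * eta by rewrite mulr_ge0 ?ltW.
(* [Fy] may lie below the global minimum [Fw], since the [y k] differ. Convexity at [b] bounds this
   gap by [H], hence by [V] and the gradients at [b]; the remaining term in [Fb - Fw] has a
   favourable sign. *)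
have hX : - 2 * eta * (Fy - Fw) <= V + 2 * L * eta ^+ 2 * (Fw - Fm)
    - 2 * eta * (1 - L * eta) * (Fb - Fw) by lra.
have hX' : - 2 * eta * (Fy - Fw) <= V + 2 * L * eta ^+ 2 * (Fw - Fm).
  apply: le_trans hX _; rewrite gerBl mulr_ge0 ?subr_ge0//.
  by rewrite !mulr_ge0 ?ltW//; lra.
have h2 : 0 <= 1 - 2 * (L * eta) by lra.
(* Replacing [Fy - Fm] by [(Fy - Fw) + (Fw - Fm)] in the main expansion leaves the factor
   [1 - 2 * (L * eta)] on [Fy - Fw], and 4 as coefficient of [L * eta ^+ 2 * (Fw - Fm)]. The present
   bound adds 2, whence the 6, and a second copy of [V]. *)
have hY : (1 - 2 * (L * eta)) * (- 2 * eta * (Fy - Fw)) <=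
    V + 2 * L * eta ^+ 2 * (Fw - Fm).
  apply: le_trans (ler_wpM2l h2 hX') _.
  rewrite ler_piMl//; last by lra.
  by rewrite addr_ge0// mulr_ge0// mulr_ge0 ?sqr_ge0// mulr_ge0 ?ltW.
lra.
Qed.

End Descent.

(** * Replacing single draws and initial segments of draws *)

Section DrawComponents.
Variables (N : nat) (n : 'I_N -> nat).

(** Together with evaluation at [i] and [k], this is a pair [upd], [get] as required by
    [avg_resample]; [dfwith] is the update of a dependent function. *)
Definition set_draw (T : nat) (i : 'I_T) (k : 'I_N) (xi : {ffun 'I_T -> Draw n})
    (j : 'I_(n k)) : {ffun 'I_T -> Draw n} :=
  [ffun r => if r == i
   then [ffun l : 'I_N => @eqtype.dfwith _ (fun l => 'I_(n l)) (xi i) k j l] : Draw n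
   else xi r].

Lemma set_draw_in T i k (xi : {ffun 'I_T -> Draw n}) (j : 'I_(n k)) :
  set_draw i xi j i k = j.
Proof. by rewrite ffunE eqxx ffunE dfwith_in. Qed.

Lemma set_draw_other_device T i k (xi : {ffun 'I_T -> Draw n}) (j : 'I_(n k)) l :
  k != l -> set_draw i xi j i l = xi i l.
Proof. by move=> kl; rewrite ffunE eqxx ffunE dfwith_out. Qed.

Lemma set_draw_other_time T i k (xi : {ffun 'I_T -> Draw n}) (j : 'I_(n k)) r :
  r != i -> set_draw i xi j r = xi r.
Proof. by move=> /negPf ri; rewrite ffunE ri. Qed.

Lemma set_drawK T i k (xi : {ffun 'I_T -> Draw n}) (j : 'I_(n k)) :
  set_draw i (set_draw i xi j) (xi i k) = xi.
Proof.
apply/ffunP => r; have [->|ri] := eqVneq r i; last first.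
  by rewrite !set_draw_other_time.
apply/ffunP => l; have [<-|kl] := eqVneq k l; first by rewrite set_draw_in.
by rewrite !set_draw_other_device.
Qed.

Definition restrict_draws (T T' : nat) (le : (T' <= T)%N)
    (xi : {ffun 'I_T -> Draw n}) : {ffun 'I_T' -> Draw n} :=
  [ffun r => xi (widen_ord le r)].

(** The [upd] matching [restrict_draws] as [get], which lets [avg_marginal] shorten the horizon. *)
Definition graft_draws (T T' : nat) (xi : {ffun 'I_T -> Draw n})
    (ze : {ffun 'I_T' -> Draw n}) : {ffun 'I_T -> Draw n} :=
  [ffun r : 'I_T => if insub (r : nat) is Some r' then ze r' else xi r].

Lemma restrict_graft T T' (le : (T' <= T)%N) xi (ze : {ffun 'I_T' -> Draw n}) :
  restrict_draws le (graft_draws xi ze) = ze.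
Proof.
apply/ffunP => r; rewrite !ffunE /= (insubT (fun r => r < T')%N (ltn_ord r)).
by congr (ze _); apply: val_inj.
Qed.

Lemma graft_restrict T T' (le : (T' <= T)%N) xi (ze : {ffun 'I_T' -> Draw n}) :
  graft_draws (graft_draws xi ze) (restrict_draws le xi) = xi.
Proof.
apply/ffunP => r; rewrite !ffunE; case: insubP => //= r' _ er.
by rewrite ffunE; congr (xi _); apply: val_inj.
Qed.

Lemma card_draws_gt0 T : (forall k, 0 < n k)%N ->
  (0 < #|{ffun 'I_T -> Draw n}|)%N.
Proof.
move=> n0; apply/card_gt0P.
by exists [ffun => [ffun k => Ordinal (n0 k)] : Draw n].
Qed.

End DrawComponents.

(** * FedAvg iterates: causality, unbiasedness and variance of one step *)

Section FedAvg.
Variables (R : realType) (m N : nat) (n : 'I_N -> nat) (p : 'I_N -> R).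
Variables (g : forall k : 'I_N, 'I_(n k) -> 'rV[R]_m -> 'rV[R]_m).
Variables (eta : nat -> R) (E : nat) (w1 : 'rV[R]_m).
Hypothesis n0 : forall k, (0 < n k)%N.
Hypothesis p1 : \sum_(k < N) p k = 1.

Local Notation loc xi s := (fedavg_loc p g eta E w1 xi s).
Local Notation mean xi s := (\sum_(k < N) p k *: loc xi s k).
Local Notation noise i k xi s :=
  (g (xi i k) (loc xi s k) - gradLloc g k (loc xi s k)).

Lemma fedavg_locS T (xi : {ffun 'I_T -> Draw n}) (i : 'I_T) :
  let v := fun k => loc xi i k - eta i.+1 *: g (xi i k) (loc xi i k) in
  loc xi i.+1 = if (E %| i.+2)%N then (fun=> \sum_(j < N) p j *: v j) else v.
Proof.
rewrite /= (insubT (fun r => r < T)%N (ltn_ord i)).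
by have -> : Sub (i : nat) (ltn_ord i) = i by apply: val_inj.
Qed.

(** Causality: the iterate at index [s] has consumed only the draws before [s], whatever the
    horizon. This is what makes it independent of the draw at index [s]. *)
Lemma fedavg_loc_local T T' (xi : {ffun 'I_T -> Draw n})
    (xi' : {ffun 'I_T' -> Draw n}) s :
  (s <= T)%N -> (s <= T')%N ->
  (forall (i : 'I_T) (i' : 'I_T'), i = i' :> nat -> (i < s)%N -> xi i = xi' i') ->
  loc xi s = loc xi' s.
Proof.
elim: s => // s IH sT sT' xx'.
rewrite (fedavg_locS xi (Ordinal sT)) (fedavg_locS xi' (Ordinal sT')) /=.
rewrite IH ?(ltnW sT) ?(ltnW sT')//; last first.
  by move=> i i' ii' si; apply: xx' => //; apply: ltnW.
by rewrite (xx' (Ordinal sT) (Ordinal sT')).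
Qed.

Lemma fedavg_loc_set_draw T (xi : {ffun 'I_T -> Draw n}) (i : 'I_T) k
    (j : 'I_(n k)) s : (s <= i)%N -> loc (set_draw i xi j) s = loc xi s.
Proof.
move=> si; have sT := leq_trans si (ltnW (ltn_ord i)).
apply: fedavg_loc_local => // r r' /val_inj <- rs.
by rewrite set_draw_other_time// -val_eqE /= ltn_eqF// (leq_trans rs).
Qed.

(** Synchronisation replaces every local model by their weighted mean, which leaves that mean
    unchanged, so both branches agree. *)
Lemma fedavg_mean_step T (xi : {ffun 'I_T -> Draw n}) (i : 'I_T) :
  mean xi i.+1 =
  mean xi i - eta i.+1 *: \sum_(k < N) p k *: g (xi i k) (loc xi i k).
Proof.
have -> : mean xi i - eta i.+1 *: \sum_(k < N) p k *: g (xi i k) (loc xi i k)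
    = \sum_(k < N) p k *: (loc xi i k - eta i.+1 *: g (xi i k) (loc xi i k)).
  rewrite scaler_sumr -sumrB; apply: eq_bigr => k _.
  by rewrite scalerBr !scalerA mulrC.
rewrite fedavg_locS; case: ifP => _ //.
by rewrite (sum_weighted_cst p1).
Qed.

Lemma fedavg_loc_sync T (xi : {ffun 'I_T -> Draw n}) (i : 'I_T) k l :
  (E %| i.+2)%N -> loc xi i.+1 k = loc xi i.+1 l.
Proof. by move=> Ei; rewrite fedavg_locS Ei. Qed.

(** Resampling the draw of device [k] at step [i] fixes both [X] and the current iterate, and
    averaging [g] over the samples gives [gradLloc]. This plays the role of conditioning on the
    past. *)
Lemma avg_dotv_noise T (i : 'I_T) k (X : {ffun 'I_T -> Draw n} -> 'rV[R]_m) :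
  (forall xi (j : 'I_(n k)), X (set_draw i xi j) = X xi) ->
  avg (fun xi => dotv (X xi) (noise i k xi i)) = 0.
Proof.
move=> Xi; have n0' : (0 < #|'I_(n k)|)%N by rewrite card_ord.
rewrite (avg_resample _ (fun xi => @set_draw_in _ _ T i k xi)
  (fun xi => @set_drawK _ _ T i k xi) n0').
rewrite -[RHS](avg_cst 0 (card_draws_gt0 T n0)); apply: eq_avg => xi.
under eq_avg => j do
  rewrite Xi (fedavg_loc_set_draw _ _ (leqnn i)) set_draw_in dotvDr.
rewrite avgD avg_cst// /avg card_ord -dotv_sumr -dotvZr.
by rewrite dotvNr -/(gradLloc g k (loc xi i k)) subrr.
Qed.

(** The noise is orthogonal on average to the deterministic part, and the noises of distinct devices
    are orthogonal to each other; only the diagonal terms, with weights [p k ^+ 2], survive. *)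
Lemma avg_fedavg_mean_step T (i : 'I_T) (wstar : 'rV[R]_m) :
  avg (fun xi : {ffun 'I_T -> Draw n} => sqnorm (mean xi i.+1 - wstar)) =
  avg (fun xi : {ffun 'I_T -> Draw n} => sqnorm (mean xi i - wstar
     - eta i.+1 *: \sum_(k < N) p k *: gradLloc g k (loc xi i k)))
  + eta i.+1 ^+ 2 * \sum_(k < N) p k ^+ 2 *
      avg (fun xi : {ffun 'I_T -> Draw n} => sqnorm (noise i k xi i)).
Proof.
pose X (xi : {ffun 'I_T -> Draw n}) := mean xi i - wstar
     - eta i.+1 *: \sum_(k < N) p k *: gradLloc g k (loc xi i k).
pose e (xi : {ffun 'I_T -> Draw n}) := \sum_(k < N) p k *: noise i k xi i.
have dec xi : sqnorm (mean xi i.+1 - wstar) =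
    sqnorm (X xi) + (- 2 * eta i.+1 * dotv (X xi) (e xi)
    + eta i.+1 ^+ 2 * sqnorm (e xi)).
  have -> : mean xi i.+1 - wstar = X xi - eta i.+1 *: e xi.
    rewrite fedavg_mean_step /X /e.
    have -> : \sum_(k < N) p k *: noise i k xi i =
       \sum_(k < N) p k *: g (xi i k) (loc xi i k)
       - \sum_(k < N) p k *: gradLloc g k (loc xi i k).
      by rewrite -sumrB; apply: eq_bigr => k _; rewrite scalerBr.
    by rewrite scalerBr opprB addrA subrK addrAC.
  by move: (X xi) (e xi) => u v; rewrite /sqnorm !dotvE (dotvC v u); ring.
rewrite (eq_avg dec) avgD avgD !avgZ -/X.
have -> : avg (fun xi => dotv (X xi) (e xi)) = 0.
  under eq_avg do rewrite dotv_sumr; rewrite avg_sum big1// => k _.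
  under eq_avg do rewrite dotvZr; rewrite avgZ avg_dotv_noise ?mulr0// => xi j.
  by rewrite /X (fedavg_loc_set_draw _ _ (leqnn i)).
rewrite mulr0 add0r; congr (_ + _ * _).
under eq_avg do rewrite /sqnorm dotv_suml.
rewrite avg_sum; apply: eq_bigr => k _.
under eq_avg do rewrite dotvZl dotv_sumr.
rewrite avgZ avg_sum (bigD1 k)//= big1 ?addr0 => [|l lk].
  by under eq_avg do rewrite dotvZr; rewrite avgZ mulrA.
under eq_avg do rewrite dotvZr; rewrite avgZ avg_dotv_noise ?mulr0// => xi j.
by rewrite (fedavg_loc_set_draw _ _ (leqnn i)) set_draw_other_device.
Qed.

(** The moment assumptions use the horizon [i.+1], the recursion a common horizon [T]; later draws
    do not affect the quantity and average out. *)
Lemma avg_horizon T (i : 'I_T) k (f : 'I_(n k) -> 'rV[R]_m -> R) :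
  avg (fun xi : {ffun 'I_T -> Draw n} => f (xi i k) (loc xi i k)) =
  avg (fun xi : {ffun 'I_i.+1 -> Draw n} => f (xi ord_max k) (loc xi i k)).
Proof.
rewrite -(avg_marginal _ (restrict_graft (ltn_ord i)) (graft_restrict (ltn_ord i)))
  ?card_draws_gt0//.
apply: eq_avg => xi; rewrite ffunE.
have -> : widen_ord (ltn_ord i) ord_max = i by apply: val_inj.
rewrite -(@fedavg_loc_local _ _ xi) ?(ltnW (ltn_ord i))// => r r' rr' _.
by rewrite ffunE; congr (xi _); apply: val_inj.
Qed.

End FedAvg.

(** * Bounds on expectations over the external randomness *)

Section MeanBounds.
Variables (R : realType) (dO : measure_display) (Omega : measurableType dO).
Variable P : probability Omega R.

(* Unlike [ge0_le_integral], no measurability: Rec is measurable at wstar only. *)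
Lemma ge0_le_integral_nomeas (f h : Omega -> \bar R) :
  (forall x, 0 <= f x)%E -> (forall x, f x <= h x)%E ->
  (\int[P]_(x in setT) f x <= \int[P]_(x in setT) h x)%E.
Proof.
move=> f0 fh; rewrite !ge0_integralTE// => [|x]; last exact: le_trans (fh x).
apply: ereal_sup_le => _ [u /= uf <-]; exists u => //= x.
exact: le_trans (uf x) (fh x).
Qed.

(** Measurability and nonnegativity travel with the bound because additivity of the integral relies
    on them; the real bound [a] also makes the integral finite. *)
Definition mean_le (F : Omega -> R) (a : R) : Prop :=
  [/\ measurable_fun setT F, forall om, 0 <= F om &
      (\int[P]_(om in setT) (F om)%:E <= a%:E)%E].

Lemma measurable_funZ (c : R) (F : Omega -> R) :
  measurable_fun setT F -> measurable_fun setT (fun om => c * F om).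
Proof. by move=> mF; apply: measurable_funM. Qed.

Lemma mean_leD (F H : Omega -> R) (a b : R) : mean_le F a -> mean_le H b ->
  mean_le (fun om => F om + H om) (a + b).
Proof.
move=> [mF F0 iF] [mH H0 iH]; split; first exact: measurable_funD.
  by move=> om; rewrite addr_ge0.
under eq_integral do rewrite EFinD.
rewrite ge0_integralD ?EFinD ?leeD//; try by move=> om _; rewrite lee_fin.
- exact/measurable_EFinP.
- exact/measurable_EFinP.
Qed.

Lemma mean_leZ c F a : 0 <= c -> mean_le F a ->
  mean_le (fun om => c * F om) (c * a).
Proof.
move=> c0 [mF F0 iF]; split; first exact: measurable_funZ.
  by move=> om; rewrite mulr_ge0.
under eq_integral do rewrite EFinM.
rewrite ge0_integralZl_EFin//; try by move=> om _; rewrite lee_fin.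
- by rewrite EFinM lee_wpmul2l ?lee_fin.
- exact/measurable_EFinP.
Qed.

Lemma mean_le_cst c : 0 <= c -> mean_le (fun=> c) c.
Proof.
move=> c0; split=> //.
have := integral_cst P measurableT c%:E => /= ->.
by rewrite probability_setT mule1.
Qed.

Lemma mean_le_sum (I : finType) (F : I -> Omega -> R) (a : I -> R) :
  (forall i, mean_le (F i) (a i)) ->
  mean_le (fun om => \sum_i F i om) (\sum_i a i).
Proof.
move=> Fa; elim: (index_enum I) => [|i r IH].
  rewrite big_nil; under [X in mean_le X]eq_fun do rewrite big_nil.
  exact: mean_le_cst.
rewrite big_cons; under [X in mean_le X]eq_fun do rewrite big_cons.
exact: mean_leD.
Qed.

Lemma le_mean_le (F H : Omega -> R) (a b : R) :
  measurable_fun setT H -> (forall om, 0 <= H om) ->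
  (forall om, H om <= F om) -> a <= b -> mean_le F a -> mean_le H b.
Proof.
move=> mH H0 HF ab [_ _ iF]; split => //.
apply: (@le_trans _ _ a%:E); last by rewrite lee_fin.
by apply: le_trans iF; apply: ge0_le_integral_nomeas => om; rewrite lee_fin.
Qed.

Lemma measurable_sqnorm m (u : Omega -> 'rV[R]_m) :
  (forall i, measurable_fun setT (fun om => u om 0 i)) ->
  measurable_fun setT (fun om => sqnorm (u om)).
Proof. by move=> mu; apply: measurable_sum => i; apply: measurable_funM. Qed.

Lemma measurable_avg (S : finType) (F : Omega -> S -> R) :
  (forall s, measurable_fun setT (F^~ s)) ->
  measurable_fun setT (fun om => avg (F om)).
Proof. by move=> mF; apply/measurable_funZ/measurable_sum. Qed.

Lemma measurable_rowD m (u v : Omega -> 'rV[R]_m) :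
  (forall i, measurable_fun setT (fun om => u om 0 i)) ->
  (forall i, measurable_fun setT (fun om => v om 0 i)) ->
  forall i, measurable_fun setT (fun om => (u om + v om) 0 i).
Proof.
move=> mu mv i; under eq_fun do rewrite mxE.
exact: measurable_funD.
Qed.

Lemma measurable_rowZ m c (u : Omega -> 'rV[R]_m) :
  (forall i, measurable_fun setT (fun om => u om 0 i)) ->
  forall i, measurable_fun setT (fun om => (c *: u om) 0 i).
Proof.
move=> mu i; under eq_fun do rewrite mxE.
exact: measurable_funZ.
Qed.

Lemma measurable_rowB m (u v : Omega -> 'rV[R]_m) :
  (forall i, measurable_fun setT (fun om => u om 0 i)) ->
  (forall i, measurable_fun setT (fun om => v om 0 i)) ->
  forall i, measurable_fun setT (fun om => (u om - v om) 0 i).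
Proof.
move=> mu mv; apply: measurable_rowD => // i.
under eq_fun do rewrite -scaleN1r.
exact: measurable_rowZ.
Qed.

Lemma measurable_row_sum m (I : finType) (u : I -> Omega -> 'rV[R]_m) :
  (forall k i, measurable_fun setT (fun om => u k om 0 i)) ->
  forall i, measurable_fun setT (fun om => (\sum_k u k om) 0 i).
Proof.
move=> mu i; under eq_fun do rewrite summxE.
exact: measurable_sum.
Qed.

End MeanBounds.

(** * Local drift, the one-step recursion and the rate *)

Section Convergence.
Variables (R : realType) (dO : measure_display) (Omega : measurableType dO).
Variable P : probability Omega R.
Variables (m N : nat) (p : 'I_N -> R) (n : 'I_N -> nat).
Variables (loss : forall k : 'I_N, 'I_(n k) -> 'rV[R]_m -> R).
Variables (g : forall k : 'I_N, 'I_(n k) -> 'rV[R]_m -> 'rV[R]_m).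
Variables (E : nat) (L mu : R) (sigma : 'I_N -> R) (G : R).
Variables (wstar : 'rV[R]_m) (Lkstar : 'I_N -> R) (w1 : Omega -> 'rV[R]_m).
Variables (eta : nat -> R) (T : nat).
Hypotheses (p0 : forall k, 0 <= p k) (p1 : \sum_(k < N) p k = 1).
Hypothesis n0 : forall k, (0 < n k)%N.
Hypotheses (E0 : (1 <= E)%N) (mu0 : 0 < mu) (L0 : 0 < L).

Local Notation loc om xi s := (fedavg_loc p g eta E (w1 om) xi s).
Local Notation mean om xi s := (\sum_(k < N) p k *: loc om xi s k).
Local Notation noise om i k xi s :=
  (g (xi i k) (loc om xi s k) - gradLloc g k (loc om xi s k)).
Local Notation draws := {ffun 'I_T -> Draw n}.

Hypothesis smoothL : forall k v w, Lloc loss k v <=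
  Lloc loss k w + dotv (v - w) (gradLloc g k w) + L / 2 * sqnorm (v - w).
Hypothesis convexL : forall k v w,
  Lloc loss k w + dotv (v - w) (gradLloc g k w) + mu / 2 * sqnorm (v - w)
    <= Lloc loss k v.
Hypothesis wstarP : forall w, Lglob p loss wstar <= Lglob p loss w.
Hypothesis LkstarP : forall k w, Lkstar k <= Lloc loss k w.
Hypothesis eta_gt0 : forall s, 0 < eta s.+1.
Hypothesis eta_le : forall s, 4 * L * eta s.+1 <= 1.
Hypothesis eta_mu : forall s, eta s.+1 * mu <= 1.
Hypothesis eta_dec : forall r s, (r <= s)%N -> eta s.+1 <= eta r.+1.
Hypothesis eta_dbl : forall r s, (s < r + E)%N -> eta r.+1 <= 2 * eta s.+1.
Hypothesis varP : forall k (s : nat),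
  (Exp P (fun om (xi : {ffun 'I_s.+1 -> Draw n}) =>
     sqnorm (noise om ord_max k xi s)) <= (sigma k ^+ 2)%:E)%E.
Hypothesis gradP : forall k (s : nat),
  (Exp P (fun om (xi : {ffun 'I_s.+1 -> Draw n}) =>
     sqnorm (g (xi ord_max k) (loc om xi s k))) <= (G ^+ 2)%:E)%E.
Hypothesis meas_loc : forall T (xi : {ffun 'I_T -> Draw n}) s k i,
  measurable_fun setT (fun om => loc om xi s k 0 i).
Hypothesis meas_grad : forall T (xi : {ffun 'I_T -> Draw n}) s k j i,
  measurable_fun setT (fun om => g (k := k) j (loc om xi s k) 0 i).

Let Gamma := Lglob p loss wstar - \sum_(k < N) p k * Lkstar k.
Let B := \sum_(k < N) p k ^+ 2 * sigma k ^+ 2 + 6 * L * Gamma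
         + 8 * (E%:R - 1) ^+ 2 * G ^+ 2.

Lemma measurable_mean (xi : draws) s i :
  measurable_fun setT (fun om => mean om xi s 0 i).
Proof.
move: i; apply: measurable_row_sum => k.
by apply: measurable_rowZ => i; apply: meas_loc.
Qed.

Lemma mean_le_noise (i : 'I_T) k : mean_le P
  (fun om => avg (fun xi : draws => sqnorm (noise om i k xi i))) (sigma k ^+ 2).
Proof.
split.
- apply: measurable_avg => xi; apply: measurable_sqnorm.
  apply: measurable_rowB => [j|]; first exact: meas_grad.
  by apply/measurable_rowZ/measurable_row_sum => j l; apply: meas_grad.
- by move=> om; apply: avg_ge0 => xi; apply: sqnorm_ge0.
- apply: le_trans (varP k i); apply: ge0_le_integral_nomeas => om.
    by rewrite lee_fin avg_ge0// => xi; apply: sqnorm_ge0.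
  by rewrite (avg_horizon _ _ _ _ _ n0 i (k := k)
    (fun j w => sqnorm (g j w - gradLloc g k w))).
Qed.

Lemma mean_le_grad (i : 'I_T) k : mean_le P
  (fun om => avg (fun xi : draws => sqnorm (g (xi i k) (loc om xi i k)))) (G ^+ 2).
Proof.
split.
- by apply: measurable_avg => xi; apply: measurable_sqnorm => j; apply: meas_grad.
- by move=> om; apply: avg_ge0 => xi; apply: sqnorm_ge0.
- apply: le_trans (gradP k i); apply: ge0_le_integral_nomeas => om.
    by rewrite lee_fin avg_ge0// => xi; apply: sqnorm_ge0.
  by rewrite (avg_horizon _ _ _ _ _ n0 i (k := k) (fun j w => sqnorm (g j w))).
Qed.

(* Young's inequality with weight j is sharp enough for induction, because
   (1 + 1/j) j^2 + (1 + j) = (j + 1)^2. *)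
Lemma mean_le_drift k r j : (r + j <= T)%N ->
  (forall q, (r < q)%N -> (q <= r + j)%N -> ~~ (E %| q.+1)%N) ->
  mean_le P (fun om => avg (fun xi : draws =>
    sqnorm (loc om xi (r + j) k - loc om xi r k))) (j%:R ^+ 2 * eta r.+1 ^+ 2 * G ^+ 2).
Proof.
elim: j => [_ _|j IH rjT nosync].
  rewrite expr0n /= !mul0r; under [X in mean_le _ X]eq_fun => om do
    under eq_avg => xi do rewrite addn0 subrr /sqnorm dotv0r.
  rewrite avg_cst; first exact: mean_le_cst.
  exact: card_draws_gt0.
rewrite addnS in rjT.
have {}IH := IH (ltnW rjT) (fun q rq qj => nosync q rq
  (leq_trans qj (leq_add (leqnn r) (leqnSn j)))).
pose i := Ordinal rjT.
have step om (xi : draws) : loc om xi (r + j.+1) k - loc om xi r k =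
    loc om xi (r + j) k - loc om xi r k
    - eta (r + j).+1 *: g (xi i k) (loc om xi i k).
  rewrite addnS (fedavg_locS _ _ _ _ _ xi i) /=.
  have := nosync (r + j).+1; rewrite addnS => /(_ _ _)/negPf-> //.
    by rewrite addrAC.
  by rewrite ltnS leq_addr.
have meas : measurable_fun setT (fun om => avg (fun xi : draws =>
    sqnorm (loc om xi (r + j.+1) k - loc om xi r k))).
  apply: measurable_avg => xi; apply/measurable_sqnorm/measurable_rowB => l;
  exact: meas_loc.
have pos om : 0 <= avg (fun xi : draws =>
    sqnorm (loc om xi (r + j.+1) k - loc om xi r k)).
  by apply: avg_ge0 => xi; apply: sqnorm_ge0.
have eta2 : eta (r + j).+1 ^+ 2 <= eta r.+1 ^+ 2.
  by rewrite ler_pXn2r ?nnegrE ?(ltW (eta_gt0 _))// eta_dec// leq_addr.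
have hG := mean_leZ (sqr_ge0 (eta (r + j).+1)) (mean_le_grad i k).
have G2 : eta (r + j).+1 ^+ 2 * G ^+ 2 <= eta r.+1 ^+ 2 * G ^+ 2.
  by rewrite ler_wpM2r ?sqr_ge0.
(* Young's weight [j] must be positive; for [j = 0] the drift is a single gradient step. *)
have [jz|jpos] := posnP j.
  apply: le_mean_le hG => // [om|].
    rewrite -avgZ; apply: le_avg => xi; rewrite step jz addn0 subrr sub0r.
    by rewrite sqnormN sqnormZ.
  by apply: le_trans G2 _; rewrite jz expr1n mul1r.
have j0 : 0 < j%:R :> R by rewrite ltr0n.
have c1 : 0 <= 1 + j%:R^-1 :> R by rewrite addr_ge0// invr_ge0 ler0n.
have c2 : 0 <= 1 + j%:R :> R by rewrite addr_ge0// ler0n.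
apply: le_mean_le (mean_leD (mean_leZ c1 IH) (mean_leZ c2 hG)) => // [om|].
  rewrite -!avgZ -avgD; apply: le_avg => xi; rewrite step.
  apply: le_trans (sqnormD_le _ _ j0) _.
  by rewrite sqnormN sqnormZ.
have := ler_wpM2l c2 G2; rewrite -(natr1 j).
have -> : (1 + j%:R^-1) * (j%:R ^+ 2 * eta r.+1 ^+ 2 * G ^+ 2) =
  (1 + j%:R) * j%:R * (eta r.+1 ^+ 2 * G ^+ 2) by field; rewrite gt_eqF.
by lra.
Qed.

Lemma last_sync s : (s <= T)%N -> exists r, [/\ (r <= s)%N, (s < r + E)%N,
  (forall q, (r < q)%N -> (q <= s)%N -> ~~ (E %| q.+1)%N) &
  forall om (xi : draws) k l, loc om xi r k = loc om xi r l].
Proof.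
(* [q0] is the last multiple of [E] up to time [s.+1]. Index [r] stands for time [r.+1], hence the
   predecessor; if [q0 = 0], then [0.-1 = 0] selects the common initial model. *)
move=> sT; pose q0 := (s.+1 %/ E * E)%N; exists q0.-1.
have q0s : (q0 <= s.+1)%N by exact: leq_trunc_div.
have sq0 : (s.+1 < q0 + E)%N.
  by rewrite {1}(divn_eq s.+1 E) ltn_add2l ltn_mod.
have r_s : (q0.-1 <= s)%N by case: q0 q0s sq0.
split => //.
- by case: q0 sq0 {q0s r_s} => [|q] //=; rewrite ?add0n ?addSn// => /ltnW.
- move=> q rq qs; apply/negP => /dvdnP[c qc].
  have : (c <= s.+1 %/ E)%N by rewrite leq_divRL// -qc ltnS.
  rewrite -(leq_pmul2r E0) -qc -/q0 => qq0.
  case: q0 rq qq0 {q0s sq0 r_s} => // q' /= h1 h2.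
  by have := leq_trans h2 h1; rewrite ltnn.
- move=> om xi k l; case eq0 : q0 => [|[|r]] //=.
  have rT : (r < T)%N by apply: leq_trans sT; move: r_s; rewrite eq0.
  apply: (@fedavg_loc_sync _ _ _ _ _ _ _ _ _ T xi (Ordinal rT)) => /=.
  by rewrite -eq0 dvdn_mull.
Qed.

Lemma convergence_step (i : 'I_T) a :
  mean_le P (fun om => avg (fun xi : draws => sqnorm (mean om xi i - wstar))) a ->
  mean_le P (fun om => avg (fun xi : draws => sqnorm (mean om xi i.+1 - wstar)))
    ((1 - eta i.+1 * mu) * a + eta i.+1 ^+ 2 * B).
Proof.
move=> ha; set e := eta i.+1.
have e0 : 0 < e := eta_gt0 i.
have [r [ri iE nosync sync]] := last_sync (ltnW (ltn_ord i)).
have eij : (i : nat) = (r + (i - r))%N by rewrite subnKC.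
have hdrift k : mean_le P (fun om => avg (fun xi : draws =>
    sqnorm (loc om xi i k - loc om xi r k))) (4 * e ^+ 2 * (E%:R - 1) ^+ 2 * G ^+ 2).
  have := @mean_le_drift k r (i - r); rewrite -eij => /(_ (ltnW (ltn_ord i)) nosync).
  apply: le_mean_le => //.
  - apply: measurable_avg => xi; apply/measurable_sqnorm/measurable_rowB => l;
    exact: meas_loc.
  - by move=> om; apply: avg_ge0 => xi; apply: sqnorm_ge0.
  rewrite ler_wpM2r ?sqr_ge0//.
  (* At most [E - 1] steps separate [r] from [i], and the step size at [r] is at most twice the
     current one; squaring gives the 4. *)
  have -> : 4 * e ^+ 2 * (E%:R - 1) ^+ 2 = (E%:R - 1) ^+ 2 * (2 * e) ^+ 2 by ring.
  have E1 : E%:R - 1 = E.-1%:R :> R by rewrite -{1}(prednK E0) -natr1 addrK.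
  apply: ler_pM; rewrite ?sqr_ge0// ?E1.
    by rewrite ler_pXn2r ?nnegrE ?ler0n// ler_nat leq_subLR -ltnS -addnS prednK.
  by rewrite ler_pXn2r ?nnegrE ?mulr_ge0 ?(ltW (eta_gt0 _))// eta_dbl.
have Gamma0 : 0 <= Gamma.
  rewrite subr_ge0; apply: ler_sum => k _; rewrite ler_wpM2l//.
have c0 : 0 <= 1 - e * mu by rewrite subr_ge0 eta_mu.
have hvar : mean_le P (fun om => e ^+ 2 * \sum_(k < N) p k ^+ 2 *
    avg (fun xi : draws => sqnorm (noise om i k xi i)))
    (e ^+ 2 * \sum_(k < N) p k ^+ 2 * sigma k ^+ 2).
  apply: mean_leZ; rewrite ?sqr_ge0//; apply: mean_le_sum => k.
  by apply: mean_leZ; rewrite ?sqr_ge0//; apply: mean_le_noise.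
have hcst : mean_le P (fun=> 6 * L * e ^+ 2 * Gamma) (6 * L * e ^+ 2 * Gamma).
  by apply: mean_le_cst; rewrite !mulr_ge0 ?sqr_ge0// ltW.
have hdr : mean_le P (fun om => 2 * \sum_(k < N) p k * avg (fun xi : draws =>
    sqnorm (loc om xi i k - loc om xi r k)))
    (2 * \sum_(k < N) p k * (4 * e ^+ 2 * (E%:R - 1) ^+ 2 * G ^+ 2)).
  by apply: mean_leZ => //; apply: mean_le_sum => k; apply: mean_leZ.
apply: le_mean_le (mean_leD (mean_leD (mean_leZ c0 ha) hcst) (mean_leD hdr hvar)).
- apply: measurable_avg => xi; apply/measurable_sqnorm/measurable_rowB => // l.
  exact: measurable_mean.
- by move=> om; apply: avg_ge0 => xi; apply: sqnorm_ge0.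
- move=> om; rewrite (avg_fedavg_mean_step _ _ _ _ n0 p1) -/e addrA lerD2r.
  have -> : \sum_(k < N) p k * avg (fun xi : draws =>
      sqnorm (loc om xi i k - loc om xi r k)) = avg (fun xi : draws =>
      \sum_(k < N) p k * sqnorm (loc om xi i k - loc om xi r k)).
    by rewrite avg_sum; apply: eq_bigr => k _; rewrite avgZ.
  rewrite -[X in _ + X + _](avg_cst _ (card_draws_gt0 T n0)) -!avgZ -!avgD.
  apply: le_avg => xi.
  apply: le_trans (descent_step p0 p1 L0 (ltW mu0) smoothL convexL LkstarP
    wstarP _ e0 (eta_le i)) _.
  rewrite -/Gamma lerD2l ler_wpM2l//.
  (* All models coincide at index [r], so any device [k0] names the common centre; the spread about
     the weighted mean is at most the spread about that centre. *)
  have [k0|] := pickP (@predT 'I_N); last first.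
    by move=> N0; rewrite !big1// => k; have := N0 k.
  move=> _; apply: le_trans (weighted_variance_le p1 (loc om xi i) (loc om xi r k0)) _.
  by apply: ler_sum => k _; rewrite (sync om xi k k0).
- by rewrite -mulr_suml p1 mul1r /B; lra.
Qed.

(** The two summands of the numerator serve the two halves of an induction: [(gamma + 1) * A] covers
    the start, [4 * B / mu ^+ 2] absorbs the noise of each step. *)
Lemma convergence_rate (gamma A : R) s :
  (forall s, eta s = 2 / (mu * (gamma + s%:R))) -> 1 <= gamma ->
  mean_le P (fun om => sqnorm (w1 om - wstar)) A -> (s <= T)%N ->
  mean_le P (fun om => avg (fun xi : draws => sqnorm (mean om xi s - wstar)))
    ((4 * B / mu ^+ 2 + (gamma + 1) * A) / (gamma + s.+1%:R)).
Proof.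
move=> etaE gamma1 hA; set v := 4 * B / _ + _.
have A0 : 0 <= A.
  case: hA => _ h0 h; rewrite -lee_fin; apply: le_trans h.
  by apply: integral_ge0 => om _; rewrite lee_fin.
have B0 : 0 <= B.
  rewrite /B !addr_ge0//.
  - by apply: sumr_ge0 => k _; rewrite mulr_ge0 ?sqr_ge0.
  - rewrite !mulr_ge0 ?(ltW L0)// subr_ge0; apply: ler_sum => k _.
    by rewrite ler_wpM2l.
  - by rewrite mulr_ge0 ?sqr_ge0// mulr_ge0 ?sqr_ge0.
have b0 : 0 <= 4 * B / mu ^+ 2 by rewrite divr_ge0 ?sqr_ge0// mulr_ge0.
have bv : 4 * B / mu ^+ 2 <= v by rewrite lerDl mulr_ge0//; lra.
elim: s => [_|s IH sT].
  apply: le_mean_le hA.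
  - apply: measurable_avg => xi; apply/measurable_sqnorm/measurable_rowB => // l.
    exact: measurable_mean.
  - by move=> om; apply: avg_ge0 => xi; apply: sqnorm_ge0.
  - move=> om; under eq_avg do rewrite (sum_weighted_cst p1).
    by rewrite avg_cst ?card_draws_gt0.
  - rewrite ler_pdivlMr; last lra.
    by rewrite mulrC /v lerDr.
apply: le_mean_le (convergence_step (i := Ordinal sT) (IH (ltnW sT))) => //.
- apply: measurable_avg => xi; apply/measurable_sqnorm/measurable_rowB => // l.
  exact: measurable_mean.
- by move=> om; apply: avg_ge0 => xi; apply: sqnorm_ge0.
rewrite /= etaE; have -> : gamma + s.+2%:R = gamma + s.+1%:R + 1 by rewrite -natr1 addrA.
have c2 : 2 <= gamma + s.+1%:R.
  by have : 0 <= s%:R :> R by []; rewrite -natr1; lra.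
move: (gamma + s.+1%:R) c2 => c c2.
(* As [4 * B / mu ^+ 2 <= v], the new bound is at most [(c - 1) * v / c ^+ 2], and
   [(c - 1) * (c + 1) <= c ^+ 2]. *)
have -> : (1 - 2 / (mu * c) * mu) * (v / c) + (2 / (mu * c)) ^+ 2 * B =
  ((c - 2) * v + 4 * B / mu ^+ 2) / c ^+ 2.
  by field; rewrite !gt_eqF//; lra.
rewrite ler_pdivrMr ?exprn_gt0//; last lra.
rewrite [leRHS]mulrAC ler_pdivlMr; last lra.
have : 4 * B / mu ^+ 2 * (c + 1) <= v * (c + 1) by rewrite ler_wpM2r//; lra.
have : 0 <= v by exact: le_trans bv.
lra.
Qed.

End Convergence.

(** * Transfer from parameter distance to reconstruction error *)

Lemma reconstruction_error (R : realType) (m d : nat)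
    (Rec : 'rV[R]_m -> 'rV[R]_d) (LR : R) (x : 'rV[R]_d) (v w : 'rV[R]_m) :
  enorm (Rec v - Rec w) <= LR * enorm (v - w) ->
  sqnorm (x - Rec v) <= 2 * sqnorm (x - Rec w) + 2 * LR ^+ 2 * sqnorm (v - w).
Proof.
move=> lip; have -> : x - Rec v = (x - Rec w) + (Rec w - Rec v).
  by rewrite addrA subrK.
(* Weight 1 in Young's inequality produces both factors 2. *)
apply: le_trans (sqnormD_le _ _ ltr01) _; rewrite invr1 -[1 + 1]/2 lerD2l.
rewrite -mulrA ler_wpM2l// sqnorm_dist -!sqnorm_enorm -exprMn.
rewrite ler_pXn2r ?nnegrE ?enorm_ge0//.
exact: le_trans (enorm_ge0 _) lip.
Qed.

Theorem theorem1
  (R : realType)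
  (* external randomness: random initialisation and randomness of the
     reconstruction function, on an arbitrary probability space *)
  (dO : measure_display) (Omega : measurableType dO) (P : probability Omega R)
  (* dimensions: model parameters in R^m, private data in R^d *)
  (m d : nat)
  (* devices, weights, dataset sizes *)
  (N : nat) (p : 'I_N -> R) (n : 'I_N -> nat)
  (* per-sample losses and their gradients *)
  (loss : forall k : 'I_N, 'I_(n k) -> 'rV[R]_m -> R)
  (g : forall k : 'I_N, 'I_(n k) -> 'rV[R]_m -> 'rV[R]_m)
  (E : nat) (L mu : R) (sigma : 'I_N -> R) (G : R)
  (wstar : 'rV[R]_m) (Lkstar : 'I_N -> R)
  (w1 : Omega -> 'rV[R]_m)
  (Rec : Omega -> 'rV[R]_m -> 'rV[R]_d) (LR : R)
  (x : 'rV[R]_d)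
  (t : nat) :
  (* weights *)
  (forall k, 0 <= p k) -> \sum_(k < N) p k = 1 ->
  (* nonempty finite datasets *)
  (forall k, (0 < n k)%N) ->
  (* g k j w is the gradient of the per-sample loss at w *)
  (forall k j w, differentiable (loss k j) w /\
      forall v, 'D_v (loss k j) w = dotv (g k j w) v) ->
  (1 <= E)%N -> 0 < mu ->
  (* (A1) L-smoothness of each local objective *)
  (forall k v w, Lloc loss k v <= Lloc loss k w + dotv (v - w) (gradLloc g k w)
                                   + L / 2 * sqnorm (v - w)) ->
  (* (A2) mu-strong convexity of each local objective *)
  (forall k v w, Lloc loss k w + dotv (v - w) (gradLloc g k w)
                   + mu / 2 * sqnorm (v - w) <= Lloc loss k v) ->
  (* w* is a minimiser of the global objective *)
  (forall w, Lglob p loss wstar <= Lglob p loss w) ->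
  (* Lkstar k is the minimum value of L_k *)
  (forall k, (forall w, Lkstar k <= Lloc loss k w) /\ exists w, Lloc loss k w = Lkstar k) ->
  let gamma := Num.max (8 * L / mu) E%:R in
  let eta := fun s : nat => 2 / (mu * (gamma + s%:R)) in
  let Gamma := Lglob p loss wstar - \sum_(k < N) p k * Lkstar k in
  let B := \sum_(k < N) p k ^+ 2 * sigma k ^+ 2 + 6 * L * Gamma
           + 8 * (E%:R - 1) ^+ 2 * G ^+ 2 in
  (* local iterate w^k_{s+1} under external randomness om and draws xi *)
  let wloc := fun (om : Omega) (T : nat) (xi : {ffun 'I_T -> Draw n}) (s : nat) (k : 'I_N) =>
                fedavg_loc p g eta E (w1 om) xi s k in
  (* (A3) bounded variance, for every k and every t' = s+1 >= 1 *)
  (forall k (s : nat),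
     (Exp P (fun om (xi : {ffun 'I_s.+1 -> Draw n}) =>
        sqnorm (g k (xi ord_max k) (wloc om _ xi s k) - gradLloc g k (wloc om _ xi s k)))
      <= (sigma k ^+ 2)%:E)%E) ->
  (* (A4) bounded second moment of the stochastic gradients *)
  (forall k (s : nat),
     (Exp P (fun om (xi : {ffun 'I_s.+1 -> Draw n}) =>
        sqnorm (g k (xi ord_max k) (wloc om _ xi s k))) <= (G ^+ 2)%:E)%E) ->
  (* regularity: the random quantities are random variables (measurable in om) *)
  (forall T (xi : {ffun 'I_T -> Draw n}) s k i,
     measurable_fun setT (fun om => wloc om T xi s k 0 i)) ->
  (forall T (xi : {ffun 'I_T -> Draw n}) s k j i,
     measurable_fun setT (fun om => g k j (wloc om T xi s k) 0 i)) ->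
  (forall i, measurable_fun setT (fun om => Rec om wstar 0 i)) ->
  (* reconstruction function is L_R-Lipschitz for every realisation *)
  (forall om v w, enorm (Rec om v - Rec om w) <= LR * enorm (v - w)) ->
  (* private data in [0,1]^d *)
  (forall i, 0 <= x 0 i <= 1) ->
  (1 <= t)%N ->
  (Exp P (fun om (xi : {ffun 'I_t -> Draw n}) =>
       sqnorm (x - Rec om (fedavg_glob p g eta E (w1 om) xi t)))
   <= 2%:E * (\int[P]_(om in setT) (sqnorm (x - Rec om wstar))%:E)
      + (2 * LR ^+ 2 / (gamma + t%:R))%:E *
        ((4 * B / mu ^+ 2)%:E
         + (gamma + 1)%:E * (\int[P]_(om in setT) (sqnorm (w1 om - wstar))%:E)))%E.
Proof.
move=> p0 p1 n0 _ E0 mu0 smoothL convexL wstarP LkstarP gamma eta Gamma B wloc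
  varP gradP meas_loc meas_grad meas_Rec lip _ t0.
have [k0 _|noI] := pickP (@predT 'I_N); last first.
  have /eqP := p1; rewrite big1 ?(eq_sym 0) ?oner_eq0// => k.
  by have := noI k.
have E1 : 1 <= E%:R :> R by rewrite ler1n.
have gammaE : E%:R <= gamma by rewrite le_max lexx orbT.
have gammaL : 8 * L / mu <= gamma by rewrite le_max lexx.
have gamma1 : 1 <= gamma by exact: le_trans gammaE.
have gt0 s : 0 < gamma + s%:R by rewrite ltr_wpDr//; lra.
pose draws := {ffun 'I_t -> Draw n}.
pose D om := avg (fun xi : draws =>
  sqnorm (fedavg_glob p g eta E (w1 om) xi t - wstar)).
have mw1 : measurable_fun setT (fun om => sqnorm (w1 om - wstar)).
  apply/measurable_sqnorm/measurable_rowB => // i.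
  (* [w1] is the iterate at index 0, here taken with the empty sequence of draws. *)
  have [xi _] := card_gt0P (card_draws_gt0 0 n0).
  exact: (meas_loc 0%N xi 0%N k0 i).
have LkstarP' k w : Lkstar k <= Lloc loss k w by case: (LkstarP k).
have mD : measurable_fun setT D.
  apply: measurable_avg => xi; apply/measurable_sqnorm/measurable_rowB => //.
  by apply: measurable_row_sum => k; apply: measurable_rowZ => i; apply: meas_loc.
have D0 om : 0 <= D om by apply: avg_ge0 => xi; apply: sqnorm_ge0.
have rate A : mean_le P (fun om => sqnorm (w1 om - wstar)) A ->
    mean_le P D ((4 * B / mu ^+ 2 + (gamma + 1) * A) / (gamma + t%:R)).
  have [[u u0]|trivial] := pselect (exists u : 'rV[R]_m, u != 0).
    (* Along a nonzero [u], the quadratic lower bound lies below the quadratic upper bound, so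
       [mu <= L]. *)
    have L0 : 0 < L.
      have u2 : 0 < sqnorm u.
        rewrite lt_neqAle sqnorm_ge0 andbT eq_sym.
        by apply: contra u0 => /eqP/sqnorm_eq0 ->.
      have := le_trans (convexL k0 u 0) (smoothL k0 u 0).
      rewrite lerD2l subr0 ler_pM2r// => h; lra.
    have eta_gt0 s : 0 < eta s.+1 by rewrite divr_gt0// mulr_gt0.
    move=> hA; have := @convergence_rate R dO Omega P m N p n loss g E L mu sigma G
      wstar Lkstar w1 eta t p0 p1 n0 E0 mu0 L0 smoothL convexL wstarP LkstarP'
      eta_gt0 _ _ _ _ varP gradP meas_loc meas_grad gamma A t.-1.
    rewrite prednK// /D /fedavg_glob -/Gamma -/B; apply => //; rewrite ?leq_pred//.
    (* The two arguments of the maximum in [gamma] serve different conditions: [8 * L / mu] gives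
       [4 * L * eta s.+1 <= 1], while [E] keeps the step size from shrinking by more than a factor 2
       within fewer than [E] steps. *)
    - move=> s; rewrite /eta mulrA ler_pdivrMr ?mulr_gt0// mul1r.
      move: gammaL; rewrite ler_pdivrMr// => gammaL.
      have : 0 <= s.+1%:R * mu by rewrite mulr_ge0 ?ltW.
      lra.
    - move=> s; rewrite /eta invfM mulrA mulrAC mulfVK ?gt_eqF//.
      rewrite ler_pdivrMr// mul1r -natr1; have : 0 <= s%:R :> R by [].
      lra.
    - move=> r s rs; rewrite /eta ler_pM2l// lef_pV2 ?posrE ?mulr_gt0//.
      by rewrite ler_pM2l// lerD2l ler_nat ltnS.
    - move=> r s rs; rewrite /eta ler_pdivrMr ?mulr_gt0//.
      have eqn b c : 0 < b -> 2 * (2 / (mu * b)) * (mu * c) = 4 * c / b.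
        by move=> b0; field; rewrite !gt_eqF.
      rewrite eqn// ler_pdivlMr//.
      have : s.+1%:R <= r.+1%:R + E%:R :> R by rewrite -natrD ler_nat addSn ltnS ltnW.
      have : 0 <= r.+1%:R :> R by [].
      lra.
  (* In dimension 0 the sign of L is unconstrained, but Gamma vanishes. *)
  have triv (u v : 'rV[R]_m) : u = v.
    have z (y : 'rV[R]_m) : y = 0.
      by apply/eqP; apply: contrapT => /negP y0; apply: trivial; exists y.
    by rewrite (z u) (z v).
  move=> [_ w0 hA].
  have A0 : 0 <= A.
    rewrite -lee_fin; apply: le_trans hA.
    by apply: integral_ge0 => om _; rewrite lee_fin.
  have Gamma00 : Gamma = 0.
    apply/eqP; rewrite subr_eq0; apply/eqP/eq_bigr => k _; congr (_ * _).
    by have [_ [w <-]] := LkstarP k; congr Lloc; apply: triv.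
  have B0 : 0 <= B.
    rewrite /B Gamma00 mulr0 addr0 addr_ge0//.
      by apply: sumr_ge0 => k _; rewrite mulr_ge0 ?sqr_ge0.
    by rewrite mulr_ge0 ?sqr_ge0// mulr_ge0 ?sqr_ge0.
  have v0 : 0 <= (4 * B / mu ^+ 2 + (gamma + 1) * A) / (gamma + t%:R).
    rewrite divr_ge0 ?(ltW (gt0 _))// addr_ge0//.
      by rewrite divr_ge0 ?sqr_ge0// mulr_ge0.
    by rewrite mulr_ge0//; lra.
  apply: le_mean_le (mean_le_cst P v0) => // om.
  rewrite /D; under eq_avg do rewrite (triv (_ - _) 0) /sqnorm dotv0r.
  by rewrite avg_cst ?card_draws_gt0.
set X := (\int[P]_(om in setT) (sqnorm (x - Rec om wstar))%:E)%E.
have mX : measurable_fun setT (fun om => sqnorm (x - Rec om wstar)).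
  exact/measurable_sqnorm/measurable_rowB.
have c0 : 0 <= 2 * LR ^+ 2 by rewrite mulr_ge0 ?sqr_ge0.
have main : (Exp P (fun om (xi : draws) =>
    sqnorm (x - Rec om (fedavg_glob p g eta E (w1 om) xi t)))
    <= 2%:E * X + (2 * LR ^+ 2)%:E * \int[P]_(om in setT) (D om)%:E)%E.
  rewrite -!ge0_integralZl_EFin//; first last.
  - exact/measurable_EFinP.
  - by move=> om _; rewrite lee_fin sqnorm_ge0.
  - exact/measurable_EFinP.
  - by move=> om _; rewrite lee_fin.
  rewrite -ge0_integralD//; first last.
  - exact/measurable_EFinP/measurable_funZ.
  - by move=> om _; rewrite lee_fin mulr_ge0.
  - exact/measurable_EFinP/measurable_funZ.
  - by move=> om _; rewrite lee_fin mulr_ge0 ?sqnorm_ge0.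
  apply: ge0_le_integral_nomeas => om; rewrite -?EFinM -?EFinD lee_fin.
    by apply: avg_ge0 => xi; apply: sqnorm_ge0.
  rewrite -[X in X + _](avg_cst _ (card_draws_gt0 t n0)) -avgZ -avgD.
  by apply: le_avg => xi; apply: reconstruction_error.
apply: le_trans main _; apply: leeD => //.
(* The initial distance may have infinite mean. For [LR = 0] both sides vanish by the convention
   [0 * +oo = 0]; otherwise an infinite mean makes the right-hand side infinite, and [rate] is
   applied only to a finite one. *)
have [LR0|LRn0] := eqVneq LR 0.
  by rewrite LR0 expr0n /= mulr0 mul0r !mul0e.
have LR2 : 0 < LR ^+ 2 by rewrite lt_neqAle sqr_ge0 eq_sym sqrf_eq0 LRn0.
set I1 := (\int[P]_(om in setT) (sqnorm (w1 om - wstar))%:E)%E.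
have I10 : (0 <= I1)%E by apply: integral_ge0 => om _; rewrite lee_fin sqnorm_ge0.
case eA : I1 I10 => [A| |] // _; last first.
  rewrite gt0_muley ?lte_fin; last lra.
  by rewrite addey// gt0_muley ?leey// lte_fin divr_gt0// mulr_gt0.
have [|_ _ hD] := rate A; first by split; [|move=> om; apply: sqnorm_ge0|rewrite -/I1 eA].
apply: le_trans (lee_wpmul2l _ hD) _; first by rewrite lee_fin.
rewrite -[leRHS]/((2 * LR ^+ 2 / (gamma + t%:R) *
  (4 * B / mu ^+ 2 + (gamma + 1) * A))%:E) -EFinM lee_fin.
by rewrite [leRHS]mulrAC -[leRHS]mulrA.
Qed.
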